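(* Let $\gamma$ be an $\mathbb{F}$-functorial. Then $h_{\tilde{\mathrm{F}}}(G)\le h_\gamma(G)\le 2h_{\tilde{\mathrm{F}}}(G)$ for every finite group $G$. Moreover, for every natural number $n$ there exists a finite group $H$ with $h_{\tilde{\mathrm{F}}}(H)=n$ and $h^*(H)=2n$.
   Context: All groups are finite. A functorial is a function $\theta$ assigning to each group $G$ a characteristic subgroup $\theta(G)$ such that $f(\theta(G))=\theta(f(G))$ for every isomorphism $f$. An $\mathbb{F}$-functorial is a functorial $\gamma$ satisfying, for every group $G$: (F1) $f(\gamma(G))\subseteq\gamma(f(G))$ for every epimorphism $f:G\to G^*$; (F2) $\gamma(N)\subseteq\gamma(G)$ for every $N\trianglelefteq G$; (F3) $C_G(\gamma(G))\subseteq\gamma(G)$; (F4) $\gamma(G)/\Phi(G)\subseteq\mathrm{Soc}(G/\Phi(G))$. $\tilde{\mathrm{F}}(G)$ is defined by $\Phi(G)\subseteq\tilde{\mathrm{F}}(G)$, $\tilde{\mathrm{F}}(G)/\Phi(G)=\mathrm{Soc}(G/\Phi(G))$; $\mathrm{F}^*(G)$ is the generalized Fitting subgroup. For a functorial $\gamma$ with $\gamma(G)>1$ for every $G\neq1$, the $\gamma$-series is $\gamma_{(0)}(G)=1$ and $\gamma_{(i+1)}(G)$ the full preimage of $\gamma(G/\gamma_{(i)}(G))$ in $G$; the $\gamma$-height $h_\gamma(G)$ is the least $h$ with $\gamma_{(h)}(G)=G$. $h^*(G)=h_{\mathrm{F}^*}(G)$. *)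

(* Defs.v *)
From mathcomp Require Import all_boot all_fingroup all_solvable.
Set Implicit Arguments. Unset Strict Implicit. Unset Printing Implicit Defensive.
Local Open Scope group_scope.

(* A map assigning to every finite group (given as a subgroup G of some
   finGroupType gT) a subset of it.  Only its values on groups matter. *)
Definition objmap := forall gT : finGroupType, {set gT} -> {set gT}.

Definition functorial (th : objmap) : Prop :=
  (forall (gT : finGroupType) (G : {group gT}),
      group_set (th gT G) /\ th gT G \char G) /\
  (forall (gT rT : finGroupType) (G : {group gT}) (f : {morphism G >-> rT}),
      'injm f -> f @* th gT G = th rT (f @* G)).

Definition Soc (gT : finGroupType) (A : {set gT}) : {set gT} :=
  <<\bigcup_(M : {group gT} | (M \subset A) && minnormal M A) M>>.

Definition F_functorial (g : objmap) : Prop :=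
  functorial g /\
  (forall (gT rT : finGroupType) (G : {group gT}) (f : {morphism G >-> rT}),
      f @* g gT G \subset g rT (f @* G)) /\
  (forall (gT : finGroupType) (G N : {group gT}), N <| G -> g gT N \subset g gT G) /\
  (forall (gT : finGroupType) (G : {group gT}), 'C_G(g gT G) \subset g gT G) /\
  (forall (gT : finGroupType) (G : {group gT}),
      g gT G / 'Phi(G) \subset Soc (G / 'Phi(G))).

Definition Ftilde : objmap := fun gT A =>
  A :&: coset 'Phi(A) @*^-1 Soc (A / 'Phi(A)).

Definition quasisimple (gT : finGroupType) (K : {set gT}) : bool :=
  (K^`(1) == K) && simple (K / 'Z(K)).

Definition layer (gT : finGroupType) (A : {set gT}) : {set gT} :=
  <<\bigcup_(K : {group gT} | (K <|<| A) && quasisimple K) K>>.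

Definition Fstar : objmap := fun gT A => 'F(A) <*> layer A.

Fixpoint gser (th : objmap) (gT : finGroupType) (G : {set gT}) (n : nat)
  : {set gT} :=
  match n with
  | 0 => 1
  | k.+1 => G :&: coset (gser th G k) @*^-1 th _ (G / gser th G k)
  end.

Definition is_height (th : objmap) (gT : finGroupType) (G : {group gT})
  (h : nat) : Prop :=
  gser th G h = G /\ (forall k, k < h -> gser th G k != G).

(* Main.v *)
(** The conditions (F1)-(F4) squeeze [gam]: by (F4) it lies below [Ftilde], and
    by (F2) and (F3) it contains the socle and every normal nilpotent subgroup,
    in particular the Frattini subgroup.  Hence [Ftilde G] lies in the second
    term of the [gam]-series, and pushing this along the quotients gives
    [gser gam G k <= gser Ftilde G k] and
    [gser Ftilde G k <= gser gam G (2 * k)].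

    For sharpness, given [H] let [W] be the regular wreath product of [Alt_5]
    by [H], with base [T]: it is the unique minimal normal subgroup of [W], it
    is nonabelian and [W / T] is [H].  Pick [q] in [T] of order 3 conjugate
    to its inverse.  Coinducing the cyclic group of order 9 from [<[q]>] to
    [W] yields an extension of [W] by an elementary abelian 3-group in which no
    lift of [q] has order 3.  A minimal supplement [Y] of the kernel is then an
    extension of [W] by some [V <= 'Phi(Y)].  If [V] were centralised by lifts
    [y], [s] of [q] and of an element inverting [q], then
    [y ^+ 3 = (y ^+ 3) ^ s = y ^- 3], so [y ^+ 3 = 1], a contradiction; hence
    [V] is its own centraliser in [Y].  Thus [Ftilde Y] is the preimage of [T], while [Fstar] needs
    two steps, [V] and then the preimage of [T]; so passing from [H] to [Y]
    raises the two heights by 1 and 2. *)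

Require Import Defs.
From HB Require Import structures.
From mathcomp Require Import all_boot all_fingroup finalg zmodp all_solvable.
Set Implicit Arguments. Unset Strict Implicit. Unset Printing Implicit Defensive.
Local Open Scope group_scope.

(** * The series of a functor compatible with epimorphisms *)

(** These properties are shared by [Soc], [Ftilde], [layer], [Fstar] and every F-functorial, and
    suffice for all series arguments. Normality follows from [epi_im] applied to conjugations. *)
Record epi_functor (th : objmap) : Prop := EpiFunctor {
  epi_group : forall (gT : finGroupType) (G : {group gT}), group_set (th gT G);
  epi_sub : forall (gT : finGroupType) (G : {group gT}), th gT G \subset G;
  epi_im : forall (gT rT : finGroupType) (G : {group gT}) (f : {morphism G >-> rT}),
    f @* th gT G \subset th rT (f @* G) }.

Lemma epi_normal th (gT : finGroupType) (G : {group gT}) :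
  epi_functor th -> th gT G <| G.
Proof.
move=> Hth; apply/andP; split; first exact: epi_sub.
apply/subsetP=> x Gx; rewrite inE.
have := epi_im Hth (restrm (subsetT G) (conjgm [set: gT] x)).
rewrite !morphim_restrm !morphim_conj !setTI (setIidPr (epi_sub Hth G)).
by rewrite setIid conjGid.
Qed.

(** As ['ker p \subset 'ker q], the map [q] factors through [p], and [epi_im] applies to the induced
    epimorphism. Stated on elements, this avoids identifying quotients of quotients. *)
Lemma epi_factor th (gT pT qT : finGroupType) (G : {group gT})
    (p : {morphism G >-> pT}) (q : {morphism G >-> qT}) x :
    epi_functor th -> 'ker p \subset 'ker q -> x \in G ->
  p x \in th pT (p @* G) -> q x \in th qT (q @* G).
Proof.
move=> Hth kpq Gx px; rewrite -(factmE kpq (subxx G) Gx).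
have := epi_im Hth (factm kpq (subxx G)).
rewrite morphim_factm => /subsetP; apply.
by rewrite mem_morphim // mem_morphim.
Qed.

Lemma gser_normal th (gT : finGroupType) (G : {group gT}) n :
  epi_functor th -> group_set (gser th G n) /\ gser th G n <| G.
Proof.
move=> Hth; elim: n => [|n [gD nD]] /=; first by split; [apply: group_set_one | apply: normal1].
pose D := group gD; have nDG : D <| G by [].
pose E := group (epi_group Hth (G / D)%G).
have nE : E <| G / D by exact: epi_normal.
have eG := quotientGK nDG.
have sEG : coset D @*^-1 E \subset G by rewrite -eG morphpreS // normal_sub.
rewrite (setIidPr sEG); split; first exact: groupP.
by have := nE; rewrite -(cosetpre_normal E) eG.
Qed.

Lemma gser_groupP th (gT : finGroupType) (G : {group gT}) n :
  epi_functor th -> exists2 D : {group gT}, gser th G n = D & D <| G.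
Proof. by move=> Hth; have [gD nD] := gser_normal G n Hth; exists (group gD). Qed.

Lemma mem_gserS th (gT : finGroupType) (G : {group gT}) n x :
    epi_functor th -> x \in G ->
  (x \in gser th G n.+1) = (coset (gser th G n) x \in th _ (G / gser th G n)).
Proof.
move=> Hth Gx /=; have [D -> nD] := gser_groupP G n Hth.
by rewrite morphpreE !in_setI Gx (subsetP (normal_norm nD)) // inE.
Qed.

(** Any epimorphism with the right kernel can replace the coset map: two maps with equal kernels
    factor through each other, so [epi_factor] applies both ways. *)
Lemma gserS_ker th (gT rT : finGroupType) (G : {group gT})
    (f : {morphism G >-> rT}) n :
    epi_functor th -> 'ker f = gser th G n ->
  gser th G n.+1 = f @*^-1 th rT (f @* G).
Proof.
move=> Hth kf; have [D eD nD] := gser_groupP G n Hth.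
have nDG := normal_norm nD.
pose q := restrm_morphism nDG (coset_morphism D).
have imq : q @* G = G / D by rewrite morphim_restrm setIid.
have kq : 'ker q = 'ker f.
  by rewrite ker_restrm ker_coset kf eD (setIidPr (normal_sub nD)).
have sS : gser th G n.+1 \subset G by exact: subsetIl.
have sf : f @*^-1 th rT (f @* G) \subset G by exact: subsetIl.
apply/setP=> x; have [Gx|nGx] := boolP (x \in G); last first.
  by rewrite (contraNF (subsetP sS x)) // (contraNF (subsetP sf x)).
rewrite mem_gserS // eD -imq morphpreE in_setI Gx inE.
apply/idP/idP.
  by apply: (@epi_factor _ _ _ _ G q f x Hth _ Gx); rewrite kq.
by apply: (@epi_factor _ _ _ _ G f q x Hth _ Gx); rewrite kq.
Qed.

Lemma gser_shift th (gT rT : finGroupType) (G : {group gT})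
    (f : {morphism G >-> rT}) j k :
    epi_functor th -> 'ker f = gser th G j ->
  gser th G (j + k) = f @*^-1 gser th (f @* G) k.
Proof.
move=> Hth kf; elim: k => [|k IH]; first by rewrite addn0 -kf.
have [D eD nD] := gser_groupP (f @* G)%G k Hth.
have nDG := normal_norm nD; rewrite /= in eD nDG nD.
have sG : G \subset f @*^-1 'N(D) by rewrite -sub_morphim_pre.
(* By induction, [h] has kernel [gser th G (j + k)], so [gserS_ker] computes the next term from
   it. *)
pose h := restrm_morphism sG [morphism of coset D \o f].
have kh : 'ker h = gser th G (j + k).
  rewrite ker_restrm ker_comp ker_coset IH eD.
  by apply/setIidPr; apply: subsetIl.
have imh : h @* G = f @* G / D by rewrite morphim_restrm setIid morphim_comp.
rewrite addnS (gserS_ker Hth kh) imh /= morphpre_restrm morphpre_comp eD.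
by rewrite morphpreI morphimGK ?subsetIl // setIA setIid.
Qed.

(** Only terms from index [j] on are visible in [f @* G], so minimality below [j] is assumed
    separately; it matters in particular when [f @* G] is trivial and [h] is 0. *)
Lemma is_height_shift th (gT rT : finGroupType) (G : {group gT})
    (f : {morphism G >-> rT}) j h :
    epi_functor th -> 'ker f = gser th G j ->
    (forall i, i < j -> gser th G i != G) ->
  is_height th (f @* G)%G h -> is_height th G (j + h).
Proof.
move=> Hth kf ltjG [eh lth]; split.
  by rewrite (gser_shift h Hth kf) eh morphimGK ?subsetIl.
move=> i; have [/ltjG // | leji] := ltnP i j.
rewrite -(subnKC leji) ltn_add2l => /lth; apply: contraNneq.
have [D eD nD] := gser_groupP (f @* G)%G (i - j) Hth.
rewrite (gser_shift _ Hth kf) /= eD => eG.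
by have := morphpreK (normal_sub nD); rewrite eG => /esym/eqP.
Qed.

(** * The socle and [Ftilde] under epimorphisms *)

Lemma Soc_sub (gT : finGroupType) (G : {group gT}) : Soc G \subset G.
Proof. by rewrite gen_subG; apply/bigcupsP=> M /andP[]. Qed.

Lemma minnormal_sub_Soc (gT : finGroupType) (G M : {group gT}) :
  M \subset G -> minnormal M G -> M \subset Soc G.
Proof. by move=> sMG minM; rewrite sub_gen // (bigcup_max M) ?sMG. Qed.

Lemma Soc_epi : epi_functor Soc.
Proof.
split=> [gT G | gT G | gT rT G f]; [exact: groupP | exact: Soc_sub |].
have sUG : \bigcup_(M : {group gT} | (M \subset G) && minnormal M G) M \subset G.
  by apply/bigcupsP=> M /andP[].
rewrite morphim_gen // gen_subG sub_morphim_pre //.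
apply/bigcupsP=> M /andP[sMG minM]; rewrite -sub_morphim_pre //.
have [-> | ntfM] := eqsVneq (f @* M) 1; first by rewrite sub1G.
have [/andP[ntM nMG] minMP] := mingroupP minM.
apply: (@minnormal_sub_Soc _ (f @* G)%G (f @* M)%G); first exact: morphimS.
apply/mingroupP; split=> [|N /andP[ntN nNG] sNM].
  by rewrite ntfM morphim_norms.
have sNfG : N \subset f @* G by rewrite (subset_trans sNM) ?morphimS.
(* A nontrivial normal [N] below [f @* M] pulls back to a nontrivial normal subgroup inside [M],
   which is [M] by minimality. So the image of [M] is trivial or again minimal normal. *)
have eN : f @* (M :&: f @*^-1 N) = N.
  by rewrite -(setIC (f @*^-1 N)) morphimGI ?ker_sub_pre // morphpreK // (setIidPl sNM).
rewrite -eN; congr (f @* _); apply: (minMP (M :&: f @*^-1 N)%G); last exact: subsetIl.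
apply/andP; split.
  by apply: contraNneq ntN => e1; rewrite -eN /= e1 morphim1.
by rewrite normsI // (subset_trans _ (morphpre_norm f N)) // -sub_morphim_pre.
Qed.

Lemma mem_Ftilde (gT : finGroupType) (G : {group gT}) x : x \in G ->
  (x \in Ftilde G) = (coset 'Phi(G) x \in Soc (G / 'Phi(G))).
Proof.
move=> Gx; have nPG := normal_norm (Phi_normal G).
by rewrite in_setI Gx morphpreE in_setI (subsetP nPG) // inE.
Qed.

Lemma epi_factor_coset th (gT qT : finGroupType) (G D : {group gT})
    (q : {morphism G >-> qT}) x :
    epi_functor th -> D <| G -> D \subset 'ker q -> x \in G ->
  coset D x \in th _ (G / D) -> q x \in th qT (q @* G).
Proof.
move=> Hth nD sDk Gx.
pose p := restrm_morphism (normal_norm nD) (coset_morphism D).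
have imp : p @* G = G / D by rewrite morphim_restrm setIid.
rewrite -imp; apply: (@epi_factor th _ _ _ G p q x Hth) => //.
by rewrite ker_restrm ker_coset subIset ?sDk ?orbT.
Qed.

(** Since [f] maps ['Phi(G)] into ['Phi(f @* G)], the map from [G] to [f @* G / 'Phi(f @* G)]
    factors through [G / 'Phi(G)], and [Soc_epi] carries the socle along. *)
Lemma Ftilde_epi : epi_functor Ftilde.
Proof.
split=> [gT G | gT G | gT rT G f]; [exact: groupP | exact: subsetIl |].
apply/subsetP=> _ /morphimP[x _ /[dup] Fx /setIP[Gx _] ->].
rewrite mem_Ftilde ?mem_morphim //=; rewrite mem_Ftilde // in Fx.
set P := 'Phi(f @* G)%G.
have nPG : f @* G \subset 'N(P) by apply/normal_norm/Phi_normal.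
have sG : G \subset f @*^-1 'N(P) by rewrite -sub_morphim_pre.
pose h := restrm_morphism sG [morphism of coset P \o f].
have imh : h @* G = f @* G / P by rewrite morphim_restrm setIid morphim_comp.
rewrite -imh; apply: (@epi_factor_coset Soc _ _ G 'Phi(G)%G h) Fx => //.
- exact: Soc_epi.
- exact: Phi_normal.
rewrite ker_restrm ker_comp ker_coset subsetI Phi_sub.
by rewrite -sub_morphim_pre ?Phi_sub // Frattini_continuous.
Qed.

Lemma F_functorial_epi gam : F_functorial gam -> epi_functor gam.
Proof.
case=> [[gamP _] [gamF1 _]]; split=> // gT G; have [gG cG] := gamP gT G => //.
exact: char_sub cG.
Qed.

(** * Bounds for F-functorials *)

Lemma epi_factor_quotient th (gT : finGroupType) (G D E : {group gT}) x :
    epi_functor th -> D <| G -> E <| G -> D \subset E -> x \in G ->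
  coset D x \in th _ (G / D) -> coset E x \in th _ (G / E).
Proof.
move=> Hth nD nE sDE Gx.
pose q := restrm_morphism (normal_norm nE) (coset_morphism E).
have imq : q @* G = G / E by rewrite morphim_restrm setIid.
rewrite -imq; apply: (@epi_factor_coset th _ _ G D q x Hth) => //.
by rewrite ker_restrm ker_coset subsetI sDE normal_sub.
Qed.

Lemma F_functorial_sub_Ftilde gam (gT : finGroupType) (G : {group gT}) :
  F_functorial gam -> gam gT G \subset Ftilde G.
Proof.
move=> Hgam; have Hep := F_functorial_epi Hgam.
have [_ [_ [_ [_ F4]]]] := Hgam; apply/subsetP=> x gx.
have Gx := subsetP (epi_sub Hep G) x gx; rewrite mem_Ftilde //.
apply: (subsetP (F4 _ _)); apply: mem_morphim => //.
exact: subsetP (normal_norm (Phi_normal G)) x Gx.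
Qed.

Lemma F_functorial_ntriv gam (gT : finGroupType) (G : {group gT}) :
  F_functorial gam -> G :!=: 1 -> gam gT G != 1.
Proof.
case=> [_ [_ [_ [F3 _]]]]; apply: contraNneq => g1.
by have := F3 _ G; rewrite g1 cent1T setIT => /trivgP->.
Qed.

Lemma F_functorial_abelian gam (gT : finGroupType) (A : {group gT}) :
  F_functorial gam -> abelian A -> gam gT A = A.
Proof.
move=> Hgam cAA; have sgA := epi_sub (F_functorial_epi Hgam) A.
have [_ [_ [_ [F3 _]]]] := Hgam; apply/eqP; rewrite eqEsubset sgA.
by apply: subset_trans (F3 _ A); rewrite subsetI subxx (subset_trans cAA) ?centS.
Qed.

Lemma F_functorial_subnormal gam (gT : finGroupType) (G H : {group gT}) :
  F_functorial gam -> H <|<| G -> gam gT H \subset gam gT G.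
Proof.
case=> [_ [_ [F2 _]]]; have [n] := ubnP #|G|.
elim: n G => // n IHn G /ltnSE-leGn /subnormalEr[-> // | [K [snHK nsKG prKG]]].
apply: subset_trans (F2 _ _ _ nsKG); apply: IHn => //.
exact: leq_trans (proper_card prKG) leGn.
Qed.

(** Each cyclic subgroup of [N] is subnormal in [G] and equals its own [gam] by (F3); (F2) then
    climbs the subnormal chain. *)
Lemma F_functorial_nilpotent gam (gT : finGroupType) (G N : {group gT}) :
  F_functorial gam -> N <| G -> nilpotent N -> N \subset gam gT G.
Proof.
move=> Hgam nsNG nilN; apply/subsetP=> x Nx.
have sn : <[x]> <|<| G.
  apply: (@subnormal_trans _ N); last exact: normal_subnormal.
  by apply: nilpotent_subnormal; rewrite ?cycle_subG.
apply: (subsetP (F_functorial_subnormal Hgam sn)).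
by rewrite (F_functorial_abelian Hgam (cycle_abelian x)) cycle_id.
Qed.

(** For a Sylow subgroup [P] of ['Phi(G)], the Frattini argument gives ['Phi(G) * 'N_G(P) = G];
    dropping the nongenerators leaves ['N_G(P) = G], so [P] is normal in [G]. *)
Lemma Phi_sub_Fitting (gT : finGroupType) (G : {group gT}) : 'Phi(G) \subset 'F(G).
Proof.
rewrite -(Sylow_gen 'Phi(G)) gen_subG; apply/bigcupsP=> P /SylowP[p _ sylP].
have eG : 'Phi(G) * 'N_G(P) = G := Frattini_arg (Phi_normal G) sylP.
have eN : 'N_G(P) = G.
  rewrite -[LHS]genGid; apply: Phi_nongen.
  by rewrite -genM_join eG genGid.
apply: Fitting_max; last exact: pgroup_nil (pHall_pgroup sylP).
rewrite /normal (subset_trans (pHall_sub sylP)) ?Phi_sub //.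
by rewrite -{1}eN subsetIr.
Qed.

(* For [M] minimal normal, the characteristic subgroup [gam M] is [M] by (F3). *)
Lemma Soc_sub_F_functorial gam (gT : finGroupType) (G : {group gT}) :
  F_functorial gam -> Soc G \subset gam gT G.
Proof.
move=> Hgam; have Hep := F_functorial_epi Hgam.
have gG := epi_group Hep G; rewrite -[gam _ _]/(gval (group gG)) gen_subG.
apply/bigcupsP=> M /andP[sMG minM]; have [/andP[ntM nMG] minMP] := mingroupP minM.
have [[gP _] [_ [F2 _]]] := Hgam; have [gM cM] := gP _ M.
have <- : gam _ M = M.
  apply: (minMP (group gM)); last exact: epi_sub.
  by rewrite /= F_functorial_ntriv // (@char_norm_trans _ (group gM) M).
by apply: F2; apply/andP.
Qed.

Lemma gser_F_functorial_sub gam (gT : finGroupType) (G : {group gT}) n :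
  F_functorial gam -> gser gam G n \subset gser Ftilde G n.
Proof.
move=> Hgam; have Hep := F_functorial_epi Hgam.
elim: n => [|n IH] //; apply/subsetP=> x /[dup] gx /setIP[Gx _]; move: gx.
rewrite (mem_gserS n Hep Gx) (mem_gserS n Ftilde_epi Gx).
have [D eD nD] := gser_groupP G n Hep; have [E eE nE] := gser_groupP G n Ftilde_epi.
rewrite eD eE in IH *.
move/(subsetP (F_functorial_sub_Ftilde (G / D)%G Hgam)).
exact: (@epi_factor_quotient Ftilde _ G D E x Ftilde_epi nD nE IH Gx).
Qed.

(* [Ftilde G / Phi G] is the socle of [G / Phi G] and [Phi G <= gam G], so the
   image of [Ftilde G] in [G / gam G] lies in the socle, hence in [gam]. *)
Lemma Ftilde_sub_gser2 gam (gT : finGroupType) (G : {group gT}) x :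
    F_functorial gam -> x \in Ftilde G ->
  coset (gam gT G) x \in gam _ (G / gam gT G).
Proof.
move=> Hgam /[dup] Fx /setIP[Gx _]; have Hep := F_functorial_epi Hgam.
move: Fx; rewrite mem_Ftilde // => Fx.
have nD := epi_normal G Hep; rewrite -[gam _ _]/(gval (group (epi_group Hep G))) in nD *.
apply: (subsetP (Soc_sub_F_functorial (G / _)%G Hgam)).
apply: epi_factor_quotient Fx => //; [exact: Soc_epi | exact: Phi_normal |].
exact: subset_trans (Phi_sub_Fitting G)
  (F_functorial_nilpotent Hgam (Fitting_normal G) (Fitting_nil G)).
Qed.

Lemma gser1 th (gT : finGroupType) (G : {group gT}) :
  epi_functor th -> gser th G 1 = th gT G.
Proof.
move=> Hth; rewrite (@gserS_ker th _ _ G (idm_morphism G) 0 Hth) ?ker_idm //.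
by rewrite morphpre_idm morphim_idm // (setIidPr (epi_sub Hth G)).
Qed.

Lemma gser_Ftilde_sub gam (gT : finGroupType) (G : {group gT}) n :
  F_functorial gam -> gser Ftilde G n \subset gser gam G (2 * n).
Proof.
move=> Hgam; have Hep := F_functorial_epi Hgam.
elim: n => [|n IH] //; apply/subsetP=> x /[dup] gx /setIP[Gx _]; move: gx.
rewrite mulnSr.
rewrite (mem_gserS n Ftilde_epi Gx).
have [D eD nD] := gser_groupP G n Ftilde_epi.
have [E eE nE] := gser_groupP G (2 * n) Hep.
pose q := restrm_morphism (normal_norm nE) (coset_morphism E).
have imq : q @* G = G / E by rewrite morphim_restrm setIid.
have kq : 'ker q = gser gam G (2 * n).
  by rewrite ker_restrm ker_coset eE (setIidPr (normal_sub nE)).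
(* The two extra [gam]-steps become the second term of the series of [G / E], where
   [Ftilde_sub_gser2] applies. *)
rewrite (gser_shift 2 Hep kq) imq; rewrite eD eE in IH *.
move/(epi_factor_quotient Ftilde_epi nD nE IH Gx) => Fx.
rewrite morphpreE in_setI Gx inE (mem_gserS 1 Hep (mem_quotient _ Gx)) (gser1 _ Hep).
exact: Ftilde_sub_gser2.
Qed.

Lemma is_height_exists th (gT : finGroupType) (G : {group gT}) m :
  gser th G m = G -> exists2 h, is_height th G h & h <= m.
Proof.
move=> em; have /ex_minnP[h /eqP eh minh] : exists n, gser th G n == G.
  by exists m; apply/eqP.
exists h; last by apply: minh; apply/eqP.
by split=> // k; rewrite ltnNge; apply: contra; apply: minh.
Qed.

Lemma gser_proper th (gT : finGroupType) (G : {group gT}) n :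
    epi_functor th ->
    (forall (rT : finGroupType) (H : {group rT}), H :!=: 1 -> th rT H != 1) ->
  gser th G n != G -> gser th G n \proper gser th G n.+1.
Proof.
move=> Hth ntth; have [D eD nD] := gser_groupP G n Hth; rewrite eD => neDG.
pose q := restrm_morphism (normal_norm nD) (coset_morphism D).
have imq : q @* G = G / D by rewrite morphim_restrm setIid.
have kq : 'ker q = D by rewrite ker_restrm ker_coset (setIidPr (normal_sub nD)).
rewrite (@gserS_ker th _ _ G q n Hth) ?kq // imq properEneq.
have sthq : th _ (G / D) \subset q @* G by rewrite imq epi_sub.
have := ker_sub_pre q (group (epi_group Hth (G / D))); rewrite kq /= => ->.
rewrite andbT.
have /ntth : (G / D)%G :!=: 1.
  by apply: contraNneq neDG => /trivgP; rewrite quotient_sub1 ?normal_norm // eqEsubset normal_sub.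
apply: contraNneq => /= eDq; rewrite -(morphpreK sthq) -eDq.
by have := morphim_ker q; rewrite kq => ->.
Qed.

Lemma gser_F_functorial_full gam (gT : finGroupType) (G : {group gT}) :
  F_functorial gam -> exists n, gser gam G n = G.
Proof.
move=> Hgam; have Hep := F_functorial_epi Hgam.
(* Terms grow strictly until [G] is reached, so a series that never reaches [G] would have a term
   with more than [#|G|] elements. *)
have /(_ #|G|.+1) [// | lt] : forall n, (exists m, gser gam G m = G) \/ n <= #|gser gam G n|.
  elim=> [|n [|IH]]; [by right | by left |].
  have [eG | neG] := eqVneq (gser gam G n) G; [by left; exists n | right].
  apply: leq_ltn_trans IH (proper_card (gser_proper Hep _ neG)) => rT H.
  exact: F_functorial_ntriv.
have [D eD nD] := gser_groupP G #|G|.+1 Hep.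
by have := subset_leq_card (normal_sub nD); rewrite -eD leqNgt lt.
Qed.

Lemma heights_F_functorial gam (gT : finGroupType) (G : {group gT}) :
    F_functorial gam ->
  exists hF hg : nat,
    [/\ is_height Ftilde G hF, is_height gam G hg & hF <= hg <= 2 * hF].
Proof.
move=> Hgam; have [m em] := gser_F_functorial_full G Hgam.
have [hg hgP _] := is_height_exists em; have [ehg _] := hgP.
(* The [Ftilde]-series dominates the [gam]-series, hence reaches [G] by index [hg]; this yields both
   the existence of [hF] and the lower bound. *)
have [|hF hFP lehF] := @is_height_exists Ftilde gT G hg.
  apply/eqP; rewrite eqEsubset.
  have := gser_F_functorial_sub G hg Hgam; rewrite ehg => ->; rewrite andbT.
  by have [D -> nD] := gser_groupP G hg Ftilde_epi; rewrite normal_sub.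
exists hF, hg; split=> //; rewrite lehF leqNgt; apply/negP=> lt2.
have [_ /(_ _ lt2)/eqP[]] := hgP; have [ehF _] := hFP.
apply/eqP; rewrite eqEsubset.
have := gser_Ftilde_sub G hF Hgam; rewrite ehF => ->; rewrite andbT.
have [D -> nD] := gser_groupP G (2 * hF) (F_functorial_epi Hgam).
exact: normal_sub.
Qed.

(** * Components and the generalized Fitting subgroup *)

(** If a normal [N] covers [K / 'Z(K)], then [K / N] is an image of ['Z(K)], hence abelian, and
    perfectness forces [N = K]. *)
Lemma quasisimpleP (gT : finGroupType) (K : {group gT}) :
  reflect [/\ K :!=: 1, K^`(1) = K &
           forall N : {group gT}, N <| K -> N :=: K \/ N \subset 'Z(K)]
          (quasisimple K).
Proof.
apply: (iffP andP) => [[/eqP pK simK] | [ntK pK dichK]].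
  have [ntKZ simKZ] := simpleP _ simK.
  split=> // [|N nsNK].
    by apply: contraNneq ntKZ => /= ->; rewrite quotient1.
  have nZN : N \subset 'N('Z(K)) by rewrite (subset_trans (normal_sub nsNK)) ?gFnorm.
  case: (simKZ (N / 'Z(K))%G); first exact: quotient_normal.
    by move=> /= N1; right; rewrite -quotient_sub1 // N1.
  move=> /= NK; left; apply/eqP; rewrite eqEsubset normal_sub //=.
  have sKNZ : K \subset 'Z(K) * N.
    by rewrite -quotientK // NK quotientGK ?center_normal.
  rewrite -{1}pK der1_min ?normal_norm //.
  apply: abelianS (quotient_abelian N (center_abelian K)).
  by rewrite -(quotientMidr N 'Z(K)) quotientS.
split; first by rewrite pK.
apply/simpleP; split=> [|N nsN].
  apply: contraNneq ntK => /= /trivgP.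
  rewrite quotient_sub1 ?gFnorm // => sKZ; rewrite -pK; apply/eqP/derG1P.
  exact: abelianS sKZ (center_abelian K).
have nsM : coset 'Z(K) @*^-1 N <| K.
  by have := nsN; rewrite -(cosetpre_normal N) (quotientGK (center_normal K)).
case: (dichK _ nsM) => /= [eK|sZ]; [right | left].
  by rewrite -(cosetpreK N) eK.
by apply/trivgP; rewrite -(cosetpreK N) quotient_sub1 ?(subset_trans sZ) ?normG.
Qed.

Lemma quasisimple_morphim (gT rT : finGroupType) (K : {group gT})
    (f : {morphism K >-> rT}) :
  quasisimple K -> f @* K != 1 -> quasisimple (f @* K).
Proof.
case/quasisimpleP=> ntK pK dichK ntfK; apply/quasisimpleP; split=> //.
  by rewrite -morphim_der // pK.
move=> N nsN; have sNfK := normal_sub nsN.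
have := dichK (f @*^-1 N)%G; case.
- have := morphpre_normal sNfK (subxx (f @* K)).
  by rewrite nsN morphimGK ?subsetIl.
- by move=> /= eK; left; rewrite -(morphpreK sNfK) eK.
move=> sZ; right; rewrite -(morphpreK sNfK).
by apply: subset_trans (morphimS f sZ) _; apply: morphim_center.
Qed.

Lemma component_normal (gT : finGroupType) (G K N : {group gT}) :
    quasisimple K -> K <|<| G -> N <| G ->
  K \subset N \/ K \subset 'C(N).
Proof.
move=> qK; have [ntK pK dichK] := quasisimpleP _ qK.
have [n] := ubnP #|G|; elim: n G N => // n IHn G N /ltnSE-leGn.
case/subnormalEr=> [eKG nsNG | [M [snKM nsMG prMG]] nsNG].
  rewrite -eKG in nsNG; case: (dichK N nsNG) => [-> | sNZ]; first by left.
  by right; rewrite centsC (subset_trans sNZ) ?subsetIr.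
have sKM := subnormal_sub snKM; have sMG := normal_sub nsMG.
case: (IHn M (N :&: M)%G) => //.
- exact: leq_trans (proper_card prMG) leGn.
- by apply: normalS (normalI nsNG nsMG); rewrite ?subsetIr.
- by rewrite subsetI => /andP[sKN _]; left.
move=> cKNM; right.
have sKNM : [~: K, N] \subset N :&: M.
  rewrite subsetI commg_subr (subset_trans sKM) ?(subset_trans sMG) ?normal_norm //=.
  rewrite (subset_trans (commSg N sKM)) // commg_subl.
  by rewrite (subset_trans (normal_sub nsNG)) ?normal_norm.
have c1 : [~: K, N, K] = 1.
  by apply/commG1P; rewrite (subset_trans sKNM) // centsC.
apply/commG1P; rewrite -{1}pK; apply: three_subgroup => //.
by rewrite [[~: N, K]]commGC.
Qed.

Lemma layer_epi : epi_functor layer.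
Proof.
split=> [gT G | gT G | gT rT G f]; first exact: groupP.
  by rewrite gen_subG; apply/bigcupsP=> K /andP[/subnormal_sub].
have sU : \bigcup_(K : {group gT} | (K <|<| G) && quasisimple K) K \subset G.
  by apply/bigcupsP=> K /andP[/subnormal_sub].
rewrite morphim_gen // gen_subG sub_morphim_pre //.
apply/bigcupsP=> K /andP[snKG qK]; have sKG := subnormal_sub snKG.
rewrite -sub_morphim_pre //.
have [-> | ntfK] := eqsVneq (f @* K) 1; first by rewrite sub1G.
rewrite sub_gen // (bigcup_max (f @* K)%G) //= morphim_subnormal //=.
have := @quasisimple_morphim _ _ K (restrm_morphism sKG f) qK.
by rewrite morphim_restrm setIid; apply.
Qed.

Lemma Fstar_epi : epi_functor Fstar.
Proof.
split=> [gT G | gT G | gT rT G f]; first exact: groupP.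
  by rewrite join_subG Fitting_sub (epi_sub layer_epi).
have lG := epi_sub layer_epi G; have FG := Fitting_sub G.
rewrite morphimY // genS // setUSS //.
  exact: morphim_Fitting.
exact: (epi_im layer_epi f).
Qed.

(** * Frattini extensions of groups with a unique minimal normal subgroup *)

(** If [N] met [T] trivially, the two would commute, putting [N] inside ['C_W(T) = 1]. *)
Lemma unique_minnormal_sub (gT : finGroupType) (W T N : {group gT}) :
    T <| W -> minnormal T W -> 'C_W(T) = 1 -> N <| W -> N :!=: 1 ->
  T \subset N.
Proof.
move=> nsTW /mingroupP[_ minT] cT nsNW ntN.
have sNW := normal_sub nsNW; have sTW := normal_sub nsTW.
have [tiNT | ntNT] := eqVneq (N :&: T) 1; last first.
  by rewrite -(minT (N :&: T)%G) ?subsetIl ?subsetIr // ntNT normal_norm // normalI.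
case/negP: ntN; rewrite -subG1 -cT subsetI sNW /=.
apply/commG1P/trivgP; rewrite -tiNT subsetI commg_subl commg_subr.
by rewrite (subset_trans sTW) ?(subset_trans sNW) ?normal_norm.
Qed.

Lemma unique_minnormal_Fitting (gT : finGroupType) (W T : {group gT}) :
    T <| W -> minnormal T W -> 'C_W(T) = 1 -> T^`(1) = T ->
  'F(W) = 1.
Proof.
move=> nsTW minT cT pT; apply/eqP; apply: contraT => ntF.
have sTF := unique_minnormal_sub nsTW minT cT (Fitting_normal W) ntF.
have [/andP[ntT _] _] := mingroupP minT.
have solT := nilpotent_sol (nilpotentS sTF (Fitting_nil W)).
by have := sol_der1_proper solT (subxx T) ntT; rewrite pT properxx.
Qed.

(** Here ['Phi(W)] lies in ['F(W) = 1], so [Ftilde W] is the socle, whose only minimal normal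
    constituent is [T]. *)
Lemma unique_minnormal_Ftilde (gT : finGroupType) (W T : {group gT}) :
    T <| W -> minnormal T W -> 'C_W(T) = 1 -> T^`(1) = T ->
  Ftilde W \subset T.
Proof.
move=> nsTW minT cT pT; apply/subsetP=> x /[dup] Fx /setIP[Wx _].
move: Fx; rewrite mem_Ftilde // => Fx.
have sSoc : Soc W \subset T.
  rewrite gen_subG; apply/bigcupsP=> M /andP[sMW minM].
  have [/andP[ntM nMW] minMP] := mingroupP minM.
  rewrite -(minMP T) // ?normal_norm ?andbT //; first by case/mingroupP: minT => /andP[].
  by apply: unique_minnormal_sub nsTW minT cT _ ntM; apply/andP.
apply: (subsetP sSoc); have := @epi_factor_coset _ _ _ W 'Phi(W)%G (idm_morphism W) x Soc_epi.
rewrite /= morphim_idm //; apply=> //; first exact: Phi_normal.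
rewrite ker_idm; apply: subset_trans (Phi_sub_Fitting W) _.
by rewrite (unique_minnormal_Fitting nsTW minT cT pT).
Qed.

Lemma unique_minnormal_Fstar (gT : finGroupType) (W T : {group gT}) :
    T <| W -> minnormal T W -> 'C_W(T) = 1 -> T^`(1) = T ->
  Fstar W \subset T.
Proof.
move=> nsTW minT cT pT; rewrite join_subG.
rewrite (unique_minnormal_Fitting nsTW minT cT pT) sub1G gen_subG.
apply/bigcupsP=> K /andP[snK qK]; case: (component_normal qK snK nsTW) => // cKT.
have [/negP[]] := quasisimpleP _ qK; rewrite -subG1 -cT subsetI cKT.
by rewrite (subnormal_sub snK).
Qed.

Section FrattiniExtension.

Variables (gT wT hT : finGroupType) (Y : {group gT}) (T : {group wT}).
Variables (p : {morphism Y >-> wT}) (f : {morphism Y >-> hT}).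
Hypotheses (nsT : T <| p @* Y) (minT : minnormal T (p @* Y)).
Hypotheses (cT : 'C_(p @* Y)(T) = 1) (pT : T^`(1) = T).
Hypothesis (sTlayer : T \subset layer (p @* Y)).
Hypotheses (abV : abelian ('ker p)) (ntV : 'ker p != 1).
Hypotheses (sVPhi : 'ker p \subset 'Phi(Y)) (cV : 'C_Y('ker p) \subset 'ker p).
Hypothesis (kerf : 'ker f = p @*^-1 T).

(** As ['ker p] lies in ['Phi(Y)], reduction modulo ['Phi(Y)] factors through [p] and sends the
    preimage of [T] into the socle. *)
Lemma Frattini_extension_Ftilde : Ftilde Y = p @*^-1 T.
Proof.
apply/eqP; rewrite eqEsubset; apply/andP; split.
  rewrite -sub_morphim_pre ?(epi_sub Ftilde_epi) //.
  apply: subset_trans (epi_im Ftilde_epi p) _.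
  exact: (@unique_minnormal_Ftilde _ (p @* Y)%G).
apply/subsetP=> x /morphpreP[Yx Tpx]; rewrite mem_Ftilde //.
pose q := restrm_morphism (normal_norm (Phi_normal Y)) (coset_morphism 'Phi(Y)).
have imq : q @* Y = Y / 'Phi(Y) by rewrite morphim_restrm setIid.
rewrite -imq; apply: (@epi_factor _ _ _ _ Y p q x Soc_epi) => //.
  by rewrite ker_restrm ker_coset (setIidPr (Phi_sub Y)).
by apply: (subsetP (@minnormal_sub_Soc _ (p @* Y)%G T (normal_sub nsT) minT)).
Qed.

(** The Fitting subgroup dies in [p @* Y]. A component lies in ['ker p] or centralises it, and [cV]
    puts it in ['ker p] in the second case too. *)
Lemma Frattini_extension_Fstar : Fstar Y = 'ker p.
Proof.
apply/eqP; rewrite eqEsubset; apply/andP; split; last first.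
  by rewrite sub_gen // subsetU // Fitting_max ?ker_normal ?abelian_nil.
rewrite join_subG; apply/andP; split.
  rewrite -sub_morphim_pre ?Fitting_sub // (subset_trans (morphim_Fitting _ _)) //.
  by rewrite (@unique_minnormal_Fitting _ (p @* Y)%G T).
rewrite gen_subG; apply/bigcupsP=> K /andP[snK qK].
have [ntK pK _] := quasisimpleP _ qK.
case: (@component_normal _ Y K ('ker p)%G qK snK) => //; first exact: ker_normal.
by move=> cK; apply: subset_trans cV; rewrite subsetI cK (subnormal_sub snK).
Qed.

Let neY1 : [1 gT] != Y :> {set gT}.
Proof.
apply: contraNneq ntV => eY; rewrite -subG1 (subset_trans (subsetIl _ _)) //.
by rewrite -eY.
Qed.

Lemma Frattini_extension_Ftilde_height n :
  is_height Ftilde (f @* Y)%G n -> is_height Ftilde Y n.+1.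
Proof.
apply: (@is_height_shift _ _ _ Y f 1 n Ftilde_epi).
  by rewrite gser1 ?kerf ?Frattini_extension_Ftilde //; apply: Ftilde_epi.
by case=> // _; apply: neY1.
Qed.

Lemma Frattini_extension_Fstar_height n :
  is_height Fstar (f @* Y)%G n -> is_height Fstar Y n.+2.
Proof.
have kp : 'ker p = gser Fstar Y 1.
  by rewrite gser1 ?Frattini_extension_Fstar //; apply: Fstar_epi.
apply: (@is_height_shift _ _ _ Y f 2 n Fstar_epi).
  rewrite (gserS_ker Fstar_epi kp) kerf; congr (_ @*^-1 _).
  apply/eqP; rewrite eqEsubset (@unique_minnormal_Fstar _ (p @* Y)%G) // andbT.
  by rewrite sub_gen // subsetU // sTlayer orbT.
case=> [|[|//]] _; first exact: neY1.
rewrite -kp; have [/andP[ntT _] _] := mingroupP minT.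
apply: contraNneq ntT => eY; rewrite -subG1 (subset_trans (normal_sub nsT)) //.
by rewrite sub_morphim_pre // -{1}eY.
Qed.

End FrattiniExtension.

(** * Regular wreath products *)

Section Wreath.

Variables A H : finGroupType.

(** Used twice: with a simple group at the bottom to build [W], and with a cyclic group at the
    bottom and [W] on top to hold the coinduced extension. *)
Definition wreath : Type := ({ffun H -> A} * H)%type.
HB.instance Definition _ := Finite.on wreath.
Implicit Types u v w : wreath.

Definition wr_mul u v : wreath := ([ffun x => u.1 x * v.1 (x * u.2)], u.2 * v.2).
Definition wr_one : wreath := ([ffun=> 1], 1).
Definition wr_inv u : wreath := ([ffun x => (u.1 (x * u.2^-1))^-1], u.2^-1).

Lemma wr_mulA : associative wr_mul.
Proof.
move=> u v w; congr pair => /=; last by rewrite mulgA.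
by apply/ffunP=> x; rewrite !ffunE !mulgA.
Qed.

Lemma wr_mul1 : left_id wr_one wr_mul.
Proof.
case=> a h; congr pair => /=; last by rewrite mul1g.
by apply/ffunP=> x; rewrite !ffunE mulg1 mul1g.
Qed.

Lemma wr_mulV : left_inverse wr_one wr_inv wr_mul.
Proof.
case=> a h; congr pair => /=; last by rewrite mulVg.
by apply/ffunP=> x; rewrite !ffunE /= mulVg.
Qed.

HB.instance Definition _ := Finite_isGroup.Build wreath wr_mulA wr_mul1 wr_mulV.

Lemma wreathP u v : u.1 =1 v.1 -> u.2 = v.2 -> u = v.
Proof. by case: u v => [a h] [b k] /= /ffunP-> ->. Qed.

Lemma wr_mul1E u v x : (u * v).1 x = u.1 x * v.1 (x * u.2).
Proof. by rewrite ffunE. Qed.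

Lemma wr_one1E x : (1 : wreath).1 x = 1.
Proof. by rewrite ffunE. Qed.

Lemma wr_inv1E u x : (u^-1).1 x = (u.1 (x * u.2^-1))^-1.
Proof. by rewrite ffunE. Qed.

Lemma wr_mul2E u v : (u * v).2 = u.2 * v.2.
Proof. by []. Qed.

Lemma wr_inv2E u : (u^-1).2 = u.2^-1.
Proof. by []. Qed.

Definition wr_top u : H := u.2.
Lemma wr_topM : {in [set: wreath] &, {morph wr_top : u v / u * v}}.
Proof. by []. Qed.
Canonical wr_top_morphism := Morphism wr_topM.

Definition wr_in (x : H) (s : A) : wreath := ([ffun y => if y == x then s else 1], 1).

Lemma wr_inM x : {in [set: A] &, {morph wr_in x : s t / s * t}}.
Proof.
move=> s t _ _; apply: wreathP => [y|]; last by rewrite /= mulg1.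
by rewrite wr_mul1E !ffunE mulg1; case: eqP; rewrite ?mulg1.
Qed.
Canonical wr_in_morphism x := Morphism (@wr_inM x).

Lemma wr_in1E x s : (wr_in x s).1 x = s.
Proof. by rewrite ffunE eqxx. Qed.

Lemma wr_inJ x s w : wr_in x s ^ w = wr_in (x * w.2) (s ^ w.1 x).
Proof.
rewrite conjgE; apply: wreathP => [y|]; last first.
  by rewrite !wr_mul2E wr_inv2E /= mul1g mulVg.
have eyx : (y == x * w.2) = (y * w.2^-1 == x).
  by rewrite -(can2_eq (mulgKV w.2) (mulgK w.2)).
rewrite !wr_mul1E wr_inv1E !ffunE wr_inv2E /= mulg1 eyx.
by case: eqP => [->|_]; rewrite ?mul1g ?mulVg.
Qed.

Lemma wr_base_gen (N : {group wreath}) :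
  (forall x, wr_in x @* [set: A] \subset N) -> 'ker wr_top \subset N.
Proof.
move=> sN; apply/subsetP=> w /morphpreP[_ /set1P w2].
(* Truncations of [w.1] to finite sets of coordinates are assembled one coordinate at a time. *)
suff Nr (r : seq H) : uniq r -> ([ffun y => if y \in r then w.1 y else 1], 1) \in N.
  have -> : w = ([ffun y => if y \in enum H then w.1 y else 1], 1).
    by apply: wreathP => // y; rewrite ffunE mem_enum.
  exact: Nr (enum_uniq H).
elim: r => [_|x r IH /= /andP[xr /IH Nr]].
  have -> : ([ffun y => if y \in [::] then w.1 y else 1], 1) = 1 :> wreath.
    by apply: wreathP => // y; rewrite !ffunE.
  exact: group1.
have -> : ([ffun y => if y \in x :: r then w.1 y else 1], 1) =
  wr_in x (w.1 x) * ([ffun y => if y \in r then w.1 y else 1], 1) :> wreath.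
  apply: wreathP => [y|]; last by rewrite /= mulg1.
  rewrite wr_mul1E !ffunE /= mulg1 inE; case: eqP => [->|_]; last by rewrite mul1g.
  by rewrite (negPf xr) mulg1.
by apply: groupM => //; apply: (subsetP (sN x)); rewrite mem_morphim ?inE.
Qed.

End Wreath.

Section SimpleWreath.

Variables S H : finGroupType.
Hypotheses (simS : simple [set: S]) (nabS : ~~ abelian [set: S]).
Let W := wreath S H.
Let T : {group W} := ('ker (@wr_top S H))%G.

Lemma simple_nonabelian_center (G : {group S}) :
  simple G -> ~~ abelian G -> 'Z(G) = 1.
Proof.
move=> /simpleP[_ simG]; case: (simG 'Z(G)%G (center_normal G)) => // /= eZ.
by rewrite -eZ center_abelian.
Qed.

Lemma simple_nonabelian_der1 (G : {group S}) :
  simple G -> ~~ abelian G -> G^`(1) = G.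
Proof.
move=> /simpleP[_ simG]; case: (simG G^`(1)%G (der_normal 1 G)) => //= eG.
by move/derG1P: eG => ->.
Qed.

Lemma simple_nonabelian_quasisimple (G : {group S}) :
  simple G -> ~~ abelian G -> quasisimple G.
Proof.
move=> simG nabG; apply/andP; split; first by rewrite simple_nonabelian_der1.
by rewrite simple_nonabelian_center // -(isog_simple (quotient1_isog G)).
Qed.

Lemma wr_base_normal : T <| [set: W].
Proof. exact: ker_normal. Qed.

Lemma wr_in_sub x : wr_in x @* [set: S] \subset T.
Proof. by apply/subsetP=> _ /morphimP[s _ _ ->]; apply/morphpreP; rewrite inE set11. Qed.

Lemma wr_in_inj x : 'injm (@wr_in S H x).
Proof.
apply/subsetP=> s /morphpreP[_ /set1P]; rewrite /= => eq1.
by rewrite inE -(wr_in1E x s) eq1 wr_one1E.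
Qed.

Lemma wr_in_morphimJ (x : H) (w : W) :
  (wr_in x @* [set: S]) :^ w = wr_in (x * w.2) @* [set: S].
Proof.
apply/setP=> u; apply/imsetP/morphimP=> [[_ /morphimP[s _ _ ->] ->]|[s _ _ ->]].
  by exists (s ^ w.1 x); rewrite ?inE //= wr_inJ.
exists (wr_in x (s ^ (w.1 x)^-1)); last by rewrite wr_inJ conjgKV.
by rewrite mem_morphim ?inE.
Qed.

Lemma wr_in_normal x : wr_in x @* [set: S] <| T.
Proof.
rewrite /normal wr_in_sub; apply/subsetP=> w /morphpreP[_ /set1P w2].
by rewrite inE wr_in_morphimJ -[w.2]/(wr_top w) w2 mulg1.
Qed.

(** If [m] in [N] has a nontrivial coordinate at [x], then commutators with the copy of [S] at [x]
    lie in [N] and in that copy. They are not all trivial as [S] has trivial centre, so simplicity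
    gives the whole copy; the top group moves it to every other. *)
Lemma wr_base_minnormal : minnormal T [set: W].
Proof.
apply/mingroupP; split=> [|N /andP[ntN nN] sNT].
  rewrite normal_norm ?wr_base_normal // andbT.
  have [ntS _] := simpleP _ simS; apply: contraNneq ntS => T1.
  by rewrite -(morphim_injm_eq1 (wr_in_inj 1)) // -subG1 -T1 wr_in_sub.
have [m Nm nt_m] : exists2 m, m \in N & m != 1.
  by apply/trivgPn.
have m2 : m.2 = 1 by have /morphpreP[_ /set1P] := subsetP sNT m Nm.
have [x mx] : exists x, m.1 x != 1.
  apply/existsP; apply: contraNT nt_m; rewrite negb_exists => /forallP m1.
  by apply/eqP; apply: wreathP => // x; rewrite wr_one1E; apply/eqP/negPn.
have nNin y : [set: S] \subset 'N(wr_in y @*^-1 N).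
  apply: subset_trans (morphpre_norm _ _); rewrite -sub_morphim_pre //.
  by rewrite (subset_trans _ nN) ?subsetT.
have sN : wr_in x @* [set: S] \subset N.
  have [_ /(_ (wr_in x @*^-1 N)%G)] := simpleP _ simS.
  rewrite /normal subsetT nNin => /(_ isT) [/= N1 | /= NS]; last first.
    by rewrite sub_morphim_pre // NS.
  case/negP: mx; rewrite -in_set1 -[[set 1]]/(1 : {set S}).
  have -> : (1 : {set S}) = 'Z([set: S]) by rewrite simple_nonabelian_center.
  rewrite inE inE /=; apply/centP=> s _; apply/commgP; rewrite -in_set1.
  have -> : [set 1] = (1 : {set S}) by [].
  rewrite -N1; apply/morphpreP; rewrite inE; split=> //=.
  have -> : wr_in x [~ m.1 x, s] = [~ m, wr_in x s].
    by rewrite !commgEr -(morphV (@wr_in_morphism S H x)) ?inE // wr_inJ m2 mulg1 wr_inM ?inE.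
  rewrite commgEl groupM ?groupV // memJ_norm //.
  by apply: (subsetP nN); rewrite inE.
apply/eqP; rewrite eqEsubset sNT /=; apply: wr_base_gen => y.
have <- : (wr_in x @* [set: S]) :^ ((1, x^-1 * y) : W) = wr_in y @* [set: S].
  by rewrite wr_in_morphimJ /= mulKVg.
by rewrite -(normsP nN _ (in_setT ((1, x^-1 * y) : W))) conjSg.
Qed.

(** A centralising [w] cannot move a copy of [S], so [w.2 = 1]; its coordinates then lie in the
    trivial centre of [S]. *)
Lemma wr_base_cent : 'C_[set: W](T) = 1.
Proof.
apply/trivgP/subsetP=> w /setIP[_ /centP cw].
have [/trivgPn[s _ nts] _] := simpleP _ simS.
have cwin x t : wr_in (x * w.2) (t ^ w.1 x) = wr_in x t.
  rewrite -wr_inJ; apply/conjg_fixP/commgP/commute_sym/cw.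
  by apply: (subsetP (wr_in_sub x)); rewrite mem_morphim ?inE.
have w2 : w.2 = 1.
  apply/eqP; apply: contraNT nts => ntw; apply/eqP.
  have := congr1 (fun u : W => u.1 1) (cwin 1 s).
  by rewrite wr_in1E ffunE mul1g eq_sym (negPf ntw) => <-.
rewrite inE; apply/eqP/wreathP => // x; rewrite wr_one1E; apply/set1P.
have <- : 'Z([set: S]) = [set 1] by rewrite simple_nonabelian_center.
rewrite inE inE /=; apply/centP=> t _; apply: commute_sym; apply/commgP/conjg_fixP.
by have /(congr1 (fun u : W => u.1 x)) := cwin x t; rewrite w2 mulg1 !wr_in1E.
Qed.

Lemma wr_base_der1 : T^`(1) = T.
Proof.
apply/eqP; rewrite eqEsubset der_sub; apply: wr_base_gen => x.
have := morphim_der (@wr_in_morphism S H x) 1 (subxx [set: S]).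
by rewrite (simple_nonabelian_der1 simS nabS) => ->; apply: dergS (wr_in_sub x).
Qed.

Lemma wr_base_layer : T \subset layer [set: W].
Proof.
apply: (@wr_base_gen _ _ (group (epi_group layer_epi [set: W]%G))) => x /=.
rewrite sub_gen // (bigcup_max (wr_in x @* [set: S])%G) //; apply/andP; split.
  apply: (@subnormal_trans _ T); apply: normal_subnormal; first exact: wr_in_normal.
  exact: wr_base_normal.
apply: (@quasisimple_morphim _ _ [set: S]%G (@wr_in_morphism S H x)).
  exact: simple_nonabelian_quasisimple.
have [ntS _] := simpleP _ simS.
by rewrite (morphim_injm_eq1 (wr_in_inj x)).
Qed.

End SimpleWreath.

(** * Extensions raising the order of an element *)

(** [chi x] is the exponent of [q] when [x] is written as a power of [q] times the chosen
    representative of [<[q]> :* x]. *)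
Lemma left_coset_coordinate (gT : finGroupType) (q : gT) :
  exists chi : gT -> nat, forall x, chi (q * x) = (chi x).+1 %[mod #[q]].
Proof.
have ex x : exists i, x = q ^+ i * repr (<[q]> :* x).
  have: x \in <[q]> :* repr (<[q]> :* x) by rewrite rcoset_repr rcoset_refl.
  by case/rcosetP=> _ /cycleP[i ->] ex; exists i.
have [chi chiP] := fin_all_exists ex; exists chi => x.
apply/eqP; rewrite -eq_expg_mod_order; apply/eqP.
apply: (mulIg (repr (<[q]> :* x))); rewrite expgS -mulgA -chiP.
rewrite [RHS]chiP; congr (_ * repr _).
by apply/esym/rcoset_eqP; rewrite mem_rcoset mulgK cycle_id.
Qed.

Section CoinducedExtension.

Variables (A W : finGroupType) (z : A) (q : W).
Let p := #[q].
Hypotheses (abA : abelian [set: A]) (zpp : z ^+ p ^+ p = 1) (zp : z ^+ p != 1).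
Variable chi : W -> nat.
Hypothesis chiP : forall x, chi (q * x) = (chi x).+1 %[mod p].

Let mulAC (a b : A) : commute a b.
Proof. by apply: (centsP abA); rewrite inE. Qed.

Let c x := z ^+ p ^+ chi x.

Let cq x : c (q * x) = z ^+ p * c x.
Proof.
rewrite /c -expgS; apply/eqP; rewrite eq_expg_mod_order.
apply/eqP; rewrite -(modn_dvdm (chi _) (m := p)); last by rewrite order_dvdn zpp.
by rewrite chiP modn_dvdm // order_dvdn zpp.
Qed.

(* The twisted condition on [p]-th powers realises the class in
   [H^2(W, Coind_<[q]>^W (Z/p))] that corresponds under Shapiro's lemma to the
   nonsplit extension of [<[q]>] by [Z/p]. *)
Definition coind_set : {set wreath A W} :=
  [set u : wreath A W | [forall x, u.1 (q * x) == u.1 x] &&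
           [forall x, u.1 x ^+ p * c x == c (x * u.2)]].

Lemma coind_setP (u : wreath A W) :
  reflect ((forall x, u.1 (q * x) = u.1 x) /\
           (forall x, u.1 x ^+ p * c x = c (x * u.2)))
          (u \in coind_set).
Proof.
rewrite inE; apply: (iffP andP) => [[/forallP u1 /forallP u2]|[u1 u2]].
  by split=> x; apply/eqP; [apply: u1 | apply: u2].
by split; apply/forallP=> x; rewrite ?u1 ?u2.
Qed.

Lemma coind_group_set : group_set coind_set.
Proof.
apply/group_setP; split=> [|u v /coind_setP[u1 u2] /coind_setP[v1 v2]].
  by apply/coind_setP; split=> x; rewrite !wr_one1E // expg1n mul1g mulg1.
apply/coind_setP; split=> x; rewrite !wr_mul1E.
  by rewrite u1 -mulgA v1.
rewrite expgMn; last exact: mulAC.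
by rewrite wr_mul2E mulgA -v2 -u2 mulgA (mulAC (u.1 x ^+ p)).
Qed.
Canonical coind_group := Group coind_group_set.

Lemma coind_topM : {in coind_group &, {morph @wr_top A W : u v / u * v}}.
Proof. by []. Qed.
Definition coind_top := Morphism coind_topM.

Lemma coind_top_surj : coind_top @* coind_group = [set: W].
Proof.
apply/eqP; rewrite eqEsubset subsetT; apply/subsetP=> w _.
(* A chosen [p]-th root depending only on the value [a]: since [d] is invariant under left
   multiplication by [q], so is its root. Each [d x] is a [p]-th power, so the default 1 is never
   taken there. *)
pose root a := odflt 1 [pick b : A | b ^+ p == a].
have rootK (b : A) : root (b ^+ p) ^+ p = b ^+ p.
  by rewrite /root; case: pickP => [d /eqP // | /(_ b)]; rewrite eqxx.
pose d x := c (x * w) * (c x)^-1.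
have dE x : d x = (z ^+ chi (x * w) * (z ^+ chi x)^-1) ^+ p.
  rewrite expgMn; last exact: mulAC.
  by rewrite expgVn /d /c -!expgM ![muln _ p]mulnC.
pose u : wreath A W := ([ffun x => root (d x)], w).
have Xu : u \in coind_group.
  apply/coind_setP; split=> x; rewrite !ffunE.
    congr root; rewrite /d -mulgA !cq invMg -(mulgA (z ^+ p)).
    by rewrite (mulAC (z ^+ p)) -!mulgA mulVg mulg1.
  by rewrite dE rootK -dE mulgKV.
by apply/morphimP; exists u.
Qed.

(** The function [u.1] is constant on [<[q]>], so [u ^+ p] has value [u.1 1 ^+ p] at 1, and the
    twisted condition makes this [c q * (c 1)^-1 = z ^+ p]. *)
Lemma coind_lift u : u \in coind_group -> u.2 = q -> u ^+ p != 1.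
Proof.
case/coind_setP=> uq uc u2.
have uqi i : u.1 (q ^+ i) = u.1 1.
  by elim: i => // i IH; rewrite expgS uq.
have uX k i : (u ^+ k).1 (q ^+ i) = u.1 1 ^+ k.
  elim: k i => [|k IH] i; first by rewrite !expg0 wr_one1E.
  by rewrite !expgS wr_mul1E uqi u2 -expgSr IH.
apply: contraNneq zp => up1; have := uX p 0; rewrite up1 wr_one1E => e.
have := uc 1; rewrite -e mul1g u2 mul1g -[c q]/(c q) => c1q.
have := cq 1; rewrite mulg1 -c1q => /eqP.
by rewrite eq_sym eq_mulgV1 mulgK.
Qed.

Lemma coind_kerP u : u \in 'ker coind_top -> u.2 = 1 /\ forall x, u.1 x ^+ p = 1.
Proof.
case/morphpreP=> /coind_setP[_ uc] /set1P u2; split=> // x.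
by have /eqP := uc x; rewrite -[u.2]/(wr_top u) u2 mulg1 eq_mulgV1 mulgK => /eqP.
Qed.

Lemma coind_ker_abelian : abelian ('ker coind_top).
Proof.
apply/centsP=> u /coind_kerP[u2 _] v /coind_kerP[v2 _].
apply: wreathP => [x|]; last by rewrite !wr_mul2E u2 v2.
by rewrite !wr_mul1E u2 v2 !mulg1; apply: mulAC.
Qed.

Lemma coind_ker_exponent u : u \in 'ker coind_top -> u ^+ p = 1.
Proof.
case/coind_kerP=> u2 up.
have uX k : (u ^+ k).2 = 1 /\ forall x, (u ^+ k).1 x = u.1 x ^+ k.
  elim: k => [|k [IH2 IH1]]; first by split=> // x; rewrite wr_one1E.
  rewrite expgS; split=> [|x]; first by rewrite wr_mul2E u2 IH2 mulg1.
  by rewrite wr_mul1E u2 mulg1 IH1 expgS.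
have [up2 up1] := uX p; apply: wreathP => // x.
by rewrite up1 up wr_one1E.
Qed.

End CoinducedExtension.

Lemma order_raising_extension (W : finGroupType) (q : W) :
    1 < #[q] ->
  exists (gT : finGroupType) (X : {group gT}) (f : {morphism X >-> W}),
    [/\ f @* X = [set: W], abelian ('ker f),
        (forall v, v \in 'ker f -> v ^+ #[q] = 1)
      & (forall u, u \in X -> f u = q -> u ^+ #[q] != 1)].
Proof.
move=> q_gt1; have [chi chiP] := left_coset_coordinate q.
(* The cyclic group of order [#[q] ^ 2], written additively on an ordinal; the form [.-1.+1] shows
   that the ordinal is nonempty. *)
pose A : finGroupType := 'I_(#[q] * #[q]).-1.+1.
have abA : abelian [set: A] by exact: FinRing.zmod_abelian.
have oz : #[Zp1 : A] = (#[q] * #[q])%N by rewrite order_Zp1 prednK // muln_gt0 order_gt0.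
have zpp : (Zp1 : A) ^+ #[q] ^+ #[q] = 1 by apply/eqP; rewrite -expgM -order_dvdn oz.
have zp : (Zp1 : A) ^+ #[q] != 1.
  rewrite -order_dvdn oz; apply/negP=> /(dvdn_leq (order_gt0 q)).
  by rewrite leqNgt ltn_Pmulr.
exists (wreath A W), (coind_group Zp1 q abA chi), (coind_top Zp1 q abA chi).
split; [exact: coind_top_surj | exact: coind_ker_abelian | |].
  by move=> v; apply: coind_ker_exponent.
by move=> u; apply: coind_lift.
Qed.

(** * Minimal supplements and self-centralising kernels *)

(** Take [Y] minimal among subgroups with full image. A maximal subgroup of [Y] missing part of the
    kernel would generate [Y] with it, hence have full image too. *)
Lemma minimal_supplement (gT wT : finGroupType) (X : {group gT})
    (f : {morphism X >-> wT}) :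
  exists Y : {group gT},
    [/\ Y \subset X, f @* Y = f @* X & 'ker_Y f \subset 'Phi(Y)].
Proof.
have [|Y minY _] := @mingroup_exists _ (fun Y => (Y \subset X) && (f @* Y == f @* X)) X.
  by rewrite subxx eqxx.
have [/andP[sYX /eqP fY] minYP] := mingroupP minY; exists Y; split=> //.
apply/bigcapsP=> M /maximal_eqP[sMY maxM].
have sKY : 'ker_Y f \subset Y by apply: subsetIl.
have nKM : M \subset 'N('ker_Y f).
  by rewrite normsI ?(subset_trans sMY) ?normG // (subset_trans sYX) ?ker_norm.
have fK : f @* 'ker_Y f = 1.
  apply/trivgP; rewrite sub_morphim_pre; first exact: subsetIr.
  exact: subset_trans sKY sYX.
case: (maxM (M <*> 'ker_Y f)%G); rewrite ?joing_subl ?join_subG ?sMY //= => eM.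
  by rewrite -eM joing_subr.
suff -> : M :=: Y by [].
apply: minYP => //; rewrite (subset_trans sMY) //= -fY -eM norm_joinEl //.
by rewrite morphimMl ?(subset_trans sMY) // fK mulg1.
Qed.

Lemma abelian_ker_cent_sub (gT wT : finGroupType) (Y : {group gT})
    (f : {morphism Y >-> wT}) (T : {group wT}) (q t : wT) (p : nat) :
    odd p -> T <| f @* Y -> minnormal T (f @* Y) -> 'C_(f @* Y)(T) = 1 ->
    abelian ('ker f) -> (forall v, v \in 'ker f -> v ^+ p = 1) ->
    q \in T -> t \in T -> q ^ t = q^-1 -> q ^+ p = 1 ->
    (forall u, u \in Y -> f u = q -> u ^+ p != 1) ->
  'C_Y('ker f) \subset 'ker f.
Proof.
move=> odd_p nsT minT cT abV expV Tq Tt qt qp lift.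
have nsC : 'C_Y('ker f) <| Y.
  by rewrite /normal subsetIl normsI ?normG // norms_cent // normal_norm ?ker_normal.
have sCY := normal_sub nsC.
have [fC1 | ntC] := eqVneq (f @* 'C_Y('ker f)) 1.
  have : 'C_Y('ker f) \subset f @*^-1 1 by rewrite -sub_morphim_pre // fC1.
  by [].
have sTC : T \subset f @* 'C_Y('ker f).
  apply: (@unique_minnormal_sub _ (f @* Y)%G T (f @* 'C_Y('ker f))%G) => //.
  exact: morphim_normal.
have /morphimP[y Yy Cy qy] := subsetP sTC q Tq.
have /morphimP[s Ys Cs ts] := subsetP sTC t Tt.
have cC a v : a \in 'C_Y('ker f) -> v \in 'ker f -> commute a v.
  by case/setIP=> _ /centP ca kv; apply: ca.
have kerE a : a \in Y -> f a = 1 -> a \in 'ker f.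
  by move=> Ya fa; apply/morphpreP; rewrite fa inE.
(* The image of [v] is [q * q ^ t = 1], so [v] is in the kernel and commutes with [y]; hence [y ^ s]
   equals [y^-1] up to a factor killed by the [p]-th power. *)
pose v := y * y ^ s.
have Yys : y ^ s \in Y by rewrite groupJ.
have kv : v \in 'ker f by apply: kerE; [rewrite groupM | rewrite morphM // morphJ // -qy -ts qt mulgV].
have kyp : y ^+ p \in 'ker f by apply: kerE; [rewrite groupX | rewrite morphX // -qy qp].
have eys : y ^ s = y^-1 * v by rewrite /v mulKg.
have ypJ : y ^+ p = y ^- p.
  have fix_yp : (y ^+ p) ^ s = y ^+ p.
    by apply/conjg_fixP/commgP/commute_sym/cC.
  rewrite -{1}fix_yp conjXg eys expgMn; first by rewrite (expV v kv) mulg1 expgVn.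
  by apply: commute_sym; apply: commuteV; apply: commute_sym; apply: cC.
case/negP: (lift y Yy (esym qy)).
have yp2 : y ^+ p ^+ 2 = 1 by rewrite expgS {1}ypJ expg1 mulVg.
rewrite -order_eq1 -dvdn1; have /eqP <- : coprime 2 p by rewrite coprime2n.
by rewrite dvdn_gcd !order_dvdn yp2 (expV _ kyp) eqxx.
Qed.

(** * Sharpness *)

Lemma Alt5_real_order3 :
  exists q t : {perm 'I_5}, [/\ q \in 'Alt_('I_5), t \in 'Alt_('I_5), #[q] = 3 & q ^ t = q^-1].
Proof.
pose i k (lk : k < 5) : 'I_5 := Ordinal lk.
(* [q] is a 3-cycle on 0, 1, 2. The transposition of 0 and 1 inverts it, and the factor moving 3 and
   4 makes [t] even. *)
pose q := tperm (@i 0%N isT) (@i 1%N isT) * tperm (@i 1%N isT) (@i 2%N isT).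
pose t := tperm (@i 0%N isT) (@i 1%N isT) * tperm (@i 3%N isT) (@i 4%N isT).
have permE5 (s s' : {perm 'I_5}) : (forall k (lk : k < 5), s (i k lk) = s' (i k lk) :> nat) -> s = s'.
  by move=> e; apply/permP=> -[k lk]; apply/val_inj/e.
exists q, t; split.
- by rewrite Alt_even odd_permM !odd_tperm.
- by rewrite Alt_even odd_permM !odd_tperm.
- apply: nt_prime_order => //.
    by apply: permE5 => -[|[|[|[|[|k]]]]] // lk; rewrite !expgS expg0 !permM !permE.
  apply/eqP=> /permP/(_ (@i 0%N isT)); rewrite permM !permE /= => /(congr1 val).
  by [].
apply: (mulgI t); rewrite -conjgC invMg !tpermV.
by apply: permE5 => -[|[|[|[|[|k]]]]] // lk; rewrite !permM !permE.
Qed.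

Lemma height_step (hT : finGroupType) (H : {group hT}) :
  exists (gT : finGroupType) (Y : {group gT}),
    (forall n, is_height Ftilde H n -> is_height Ftilde Y n.+1) /\
    (forall n, is_height Fstar H n -> is_height Fstar Y n.+2).
Proof.
have [q0 [t0 [Aq0 At0 oq0 qt0]]] := Alt5_real_order3.
pose S : finGroupType := subg_of 'Alt_('I_5); pose K : finGroupType := subg_of H.
pose q : S := subg _ q0; pose t : S := subg _ t0.
have oq : #[q] = 3 by rewrite order_injm ?injm_subg.
have qt : q ^ t = q^-1 by rewrite -morphJ // qt0 morphV.
have simS : simple [set: S].
  by rewrite -(isog_simple (isog_subg 'Alt_('I_5))) simple_Alt5 // card_ord.
have nabS : ~~ abelian [set: S].
  apply/negP=> abS; suff: #[q] %| 2 by rewrite oq.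
  rewrite order_dvdn expgS expg1 -{1}[q]invgK -qt.
  have /conjg_fixP -> : [~ q, t] == 1 by apply/commgP/(centsP abS); rewrite inE.
  by rewrite mulVg.
pose W : finGroupType := wreath S K.
pose qW : W := wr_in 1 q; pose tW : W := wr_in 1 t.
have oqW : #[qW] = 3 by rewrite (order_injm (@wr_in_inj S K 1)) ?inE.
have qtW : qW ^ tW = qW^-1.
  rewrite -(morphJ (@wr_in_morphism S K 1)) ?inE // qt.
  by rewrite (morphV (@wr_in_morphism S K 1)) ?inE.
have [|gT [X [f [fX abX expX liftX]]]] := @order_raising_extension W qW; first by rewrite oqW.
have [Y [sYX fY sVPhi]] := minimal_supplement f.
pose T : {group W} := ('ker (@wr_top S K))%G.
pose p := restrm_morphism sYX f.
have pY : p @* Y = [set: W] by rewrite morphim_restrm setIid fY.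
have kp : 'ker p = 'ker_Y f by rewrite ker_restrm.
have sk v : v \in 'ker p -> v \in 'ker f by rewrite kp => /setIP[].
have abV : abelian ('ker p) by apply: abelianS abX; apply/subsetP.
have Tin s : wr_in 1 s \in T.
  by apply: (subsetP (@wr_in_sub S K 1)); rewrite mem_morphim ?inE.
have liftY u : u \in Y -> p u = qW -> u ^+ 3 != 1.
  by move=> Yu pu; rewrite -oqW liftX // (subsetP sYX).
have nsT : T <| p @* Y by rewrite pY wr_base_normal.
have minT : minnormal T (p @* Y) by rewrite pY wr_base_minnormal.
have cT : 'C_(p @* Y)(T) = 1 by rewrite pY wr_base_cent.
have cV : 'C_Y('ker p) \subset 'ker p.
  apply: (@abelian_ker_cent_sub _ _ Y p T qW tW 3) => //.
  - by move=> v /sk; rewrite -oqW; apply: expX.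
  - exact: Tin.
  - exact: Tin.
  by rewrite -oqW expg_order.
have sTl : T \subset layer (p @* Y) by rewrite pY wr_base_layer.
have /morphimP[y Yy _ qy] : qW \in p @* Y by rewrite pY inE.
(* The cube of a lift of [qW] maps to 1 but is nontrivial. *)
have ntV : 'ker p != 1.
  apply/trivgPn; exists (y ^+ 3); last by rewrite liftY.
  by apply/morphpreP; rewrite groupX // inE morphX // -qy -oqW expg_order.
(* The composite of [p] with the projection of [W] onto its top group; its kernel is the preimage of
   the base [T]. *)
have hM : {in Y &, {morph (fun x => sgval (wr_top (p x))) : x y / x * y}}.
  by move=> x x' Yx Yx'; rewrite morphM.
pose h := Morphism hM.
have hY : (h @* Y)%G = H.
  apply/val_inj/setP=> x /=; apply/morphimP/idP=> [[u _ _ ->]|Hx]; first exact: subgP.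
  have /morphimP[u Yu _ eu] : ((1, subg H x) : W) \in p @* Y by rewrite pY inE.
  exists u => //; rewrite -[h u]/(sgval (wr_top (p u))) -eu.
  exact: esym (subgK _ Hx).
have kh : 'ker h = p @*^-1 T.
  apply/setP=> x; apply/morphpreP/morphpreP=> -[Yx hx]; split=> //.
    apply/morphpreP; split; first by rewrite inE.
    by apply/set1P/val_inj; have /set1P := hx.
  by case/morphpreP: hx => _ /set1P hx; apply/set1P; exact: (congr1 sgval hx).
have pT : T^`(1) = T by apply: wr_base_der1.
have sVp : 'ker p \subset 'Phi(Y) by rewrite kp.
exists gT, Y; rewrite -hY; split=> n.
  exact: (@Frattini_extension_Ftilde_height _ _ _ Y T p h).
exact: (@Frattini_extension_Fstar_height _ _ _ Y T p h).
Qed.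

Local Close Scope group_scope.

Theorem theorem6 (gam : objmap) (Hgam : F_functorial gam) :
  (forall (gT : finGroupType) (G : {group gT}),
     exists hF hg : nat,
       [/\ is_height Ftilde G hF, is_height gam G hg & hF <= hg <= 2 * hF]) /\
  (forall n : nat, exists (gT : finGroupType) (H : {group gT}),
       is_height Ftilde H n /\ is_height Fstar H (2 * n)).
Proof.
split=> [gT G|n]; first exact: heights_F_functorial.
elim: n => [|n [hT [H [hF hs]]]].
  by exists {perm 'I_0}, 1%G.
have [gT [Y [stepF steps]]] := height_step H.
by exists gT, Y; split; [apply: stepF | rewrite mulnS; apply: steps].
Qed.
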